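(* Suppose the curved $N$-body problem in $\mathbb S^3$ has a solution of the positive elliptic-elliptic form $w_i=r_i(t)\cos[\alpha(t)+a_i]$, $x_i=r_i(t)\sin[\alpha(t)+a_i]$, $y_i=\rho_i(t)\cos[\beta(t)+b_i]$, $z_i=\rho_i(t)\sin[\beta(t)+b_i]$, with $a_i,b_i$ constants, $\alpha,\beta$ nonconstant, $0\le r_i,\rho_i\le1$, $r_i^2+\rho_i^2=1$, and let $c_1,c_2\neq0$ be the constants for which $\dot\alpha=c_1/\sum_jm_jr_j^2$ and $\dot\beta=c_2/(M-\sum_jm_jr_j^2)$, where $M=\sum_jm_j$. Write $\gamma_i^-=\alpha-\beta+a_i-b_i$ and $\gamma_i^+=\alpha+\beta+a_i+b_i$. Then the following expressions are constant in time: (energy) $$h=\sum_{i=1}^N\frac{m_i\dot r_i^2}{2(1-r_i^2)}+\frac{c_1^2}{2\sum_jm_jr_j^2}+\frac{c_2^2}{2(M-\sum_jm_jr_j^2)}-\sum_{1\le i<j\le N}\frac{m_im_jq_{ij}}{(1-q_{ij}^2)^{1/2}};$$ and the total angular momenta relative to the base planes are the constants $c_{wx}=c_1$; $$c_{wy}=\frac12\sum_{i=1}^Nm_i\Big[r_i(1-r_i^2)^{1/2}(\dot\alpha+\dot\beta)\sin\gamma_i^-+r_i(1-r_i^2)^{1/2}(\dot\alpha-\dot\beta)\sin\gamma_i^+-\frac{\dot r_i}{(1-r_i^2)^{1/2}}\cos\gamma_i^--\frac{\dot r_i}{(1-r_i^2)^{1/2}}\cos\gamma_i^+\Big];$$ $$c_{wz}=\frac12\sum_{i=1}^Nm_i\Big[r_i(1-r_i^2)^{1/2}(\dot\alpha+\dot\beta)\cos\gamma_i^--r_i(1-r_i^2)^{1/2}(\dot\alpha-\dot\beta)\cos\gamma_i^++\frac{\dot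 r_i}{(1-r_i^2)^{1/2}}\sin\gamma_i^--\frac{\dot r_i}{(1-r_i^2)^{1/2}}\sin\gamma_i^+\Big];$$ $$c_{xy}=-\frac12\sum_{i=1}^Nm_i\Big[r_i(1-r_i^2)^{1/2}(\dot\alpha+\dot\beta)\cos\gamma_i^-+r_i(1-r_i^2)^{1/2}(\dot\alpha-\dot\beta)\cos\gamma_i^++\frac{\dot r_i}{(1-r_i^2)^{1/2}}\sin\gamma_i^-+\frac{\dot r_i}{(1-r_i^2)^{1/2}}\sin\gamma_i^+\Big];$$ $$c_{xz}=\frac12\sum_{i=1}^Nm_i\Big[r_i(1-r_i^2)^{1/2}(\dot\alpha+\dot\beta)\sin\gamma_i^--r_i(1-r_i^2)^{1/2}(\dot\alpha-\dot\beta)\sin\gamma_i^+-\frac{\dot r_i}{(1-r_i^2)^{1/2}}\cos\gamma_i^-+\frac{\dot r_i}{(1-r_i^2)^{1/2}}\cos\gamma_i^+\Big];$$ $c_{yz}=c_2$.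
   Context: Masses $m_1,\dots,m_N>0$, $N\ge 2$; dots denote $d/dt$. $\mathbb S^3=\{(w,x,y,z)\in\mathbb R^4: w^2+x^2+y^2+z^2=1\}$, $\cdot$ is the standard inner product, $\mathbf q_i=(w_i,x_i,y_i,z_i)$, $q_{ij}:=\mathbf q_i\cdot\mathbf q_j$, $\dot q_{ii}:=\dot{\mathbf q}_i\cdot\dot{\mathbf q}_i$. The curved $N$-body problem in $\mathbb S^3$ is the system $$\ddot{\mathbf q}_i=\sum_{j\ne i}\frac{m_j(\mathbf q_j-q_{ij}\mathbf q_i)}{(1-q_{ij}^2)^{3/2}}-\dot q_{ii}\mathbf q_i,\quad q_{ii}=1,\quad i=1,\dots,N.$$ The total angular momentum relative to the base plane $uv$, for two of the coordinates $u,v\in\{w,x,y,z\}$ (taken in this order), is $c_{uv}=\sum_{i=1}^Nm_i(u_i\dot v_i-\dot u_iv_i)$. The total energy is $h=\frac12\sum_im_i\dot q_{ii}-\sum_{i<j}m_im_jq_{ij}(1-q_{ij}^2)^{-1/2}$. For solutions of the stated form, $\dot\alpha$ and $\dot\beta$ have the expressions in the claim for some nonzero constants $c_1,c_2$. *)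

(* Defs.v *)
From HB Require Import structures.
From mathcomp Require Import all_boot all_order all_algebra.
From mathcomp Require Import all_classical all_reals all_analysis.
Set Implicit Arguments.
Unset Strict Implicit.
Unset Printing Implicit Defensive.
Import Order.TTheory GRing.Theory Num.Theory.
Import numFieldNormedType.Exports.
Local Open Scope classical_set_scope.
Local Open Scope ring_scope.

(* The coordinates (w, x, y, z) of R^4. *)
Definition wc : 'I_4 := @Ordinal 4 0 isT.
Definition xc : 'I_4 := @Ordinal 4 1 isT.
Definition yc : 'I_4 := @Ordinal 4 2 isT.
Definition zc : 'I_4 := @Ordinal 4 3 isT.

Definition dot (R : realType) (u v : 'rV[R]_4) : R :=
  \sum_(k < 4) u 0 k * v 0 k.

(* Right-hand side of the equation of motion of body i. *)
Definition acceleration (R : realType) (N : nat) (m : 'I_N -> R)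
    (q : 'I_N -> R -> 'rV[R]_4) (i : 'I_N) (t : R) : 'rV[R]_4 :=
  \sum_(j < N | j != i)
     (m j / (1 - dot (q i t) (q j t) ^+ 2) `^ (3 / 2)) *:
       (q j t - dot (q i t) (q j t) *: q i t)
  - dot (derive1 (q i) t) (derive1 (q i) t) *: q i t.

(* q solves the curved N-body problem in S^3 on the time interval I.  The
   condition q_ij ^ 2 <> 1 excludes collisions and antipodal configurations,
   where the equations of motion are not defined. *)
Record curved_Nbody_solution (R : realType) (N : nat) (m : 'I_N -> R)
    (I : set R) (q : 'I_N -> R -> 'rV[R]_4) : Prop := CurvedNbodySolution {
  sol_sphere : forall i t, I t -> dot (q i t) (q i t) = 1;
  sol_nonsingular : forall i j t, I t -> i != j ->
    dot (q i t) (q j t) ^+ 2 <> 1;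
  sol_derivable : forall i t, I t -> derivable (q i) t 1;
  sol_derivable2 : forall i t, I t -> derivable (derive1 (q i)) t 1;
  sol_motion : forall i t, I t -> derive1 (derive1 (q i)) t = acceleration m q i t
}.

Record positive_elliptic_elliptic (R : realType) (N : nat) (I : set R)
    (q : 'I_N -> R -> 'rV[R]_4) (r rho : 'I_N -> R -> R) (alpha beta : R -> R)
    (a b : 'I_N -> R) : Prop := PositiveEllipticElliptic {
  ee_w : forall i t, I t -> q i t 0 wc = r i t * cos (alpha t + a i);
  ee_x : forall i t, I t -> q i t 0 xc = r i t * sin (alpha t + a i);
  ee_y : forall i t, I t -> q i t 0 yc = rho i t * cos (beta t + b i);
  ee_z : forall i t, I t -> q i t 0 zc = rho i t * sin (beta t + b i);
  ee_derivable_r : forall i t, I t -> derivable (r i) t 1;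
  ee_derivable_rho : forall i t, I t -> derivable (rho i) t 1;
  ee_derivable_alpha : forall t, I t -> derivable alpha t 1;
  ee_derivable_beta : forall t, I t -> derivable beta t 1;
  ee_alpha_nonconstant : ~ (exists c, forall t, I t -> alpha t = c);
  ee_beta_nonconstant : ~ (exists c, forall t, I t -> beta t = c);
  ee_r_bounds : forall i t, I t -> 0 <= r i t <= 1;
  ee_rho_bounds : forall i t, I t -> 0 <= rho i t <= 1;
  ee_r_rho : forall i t, I t -> r i t ^+ 2 + rho i t ^+ 2 = 1
}.

Definition angular_momentum (R : realType) (N : nat) (m : 'I_N -> R)
    (q : 'I_N -> R -> 'rV[R]_4) (u v : 'I_4) (t : R) : R :=
  \sum_(i < N) m i * (q i t 0 u * derive1 (q i) t 0 v - derive1 (q i) t 0 u * q i t 0 v).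

(* The sum over i < j of m_i m_j q_ij / (1 - q_ij^2)^(1/2). *)
Definition force_function (R : realType) (N : nat) (m : 'I_N -> R)
    (q : 'I_N -> R -> 'rV[R]_4) (t : R) : R :=
  \sum_(i < N) \sum_(j < N | (i < j)%N)
     m i * m j * dot (q i t) (q j t) / Num.sqrt (1 - dot (q i t) (q j t) ^+ 2).

Definition total_energy (R : realType) (N : nat) (m : 'I_N -> R)
    (q : 'I_N -> R -> 'rV[R]_4) (t : R) : R :=
  2^-1 * (\sum_(i < N) m i * dot (derive1 (q i) t) (derive1 (q i) t))
  - force_function m q t.

Definition total_mass (R : realType) (N : nat) (m : 'I_N -> R) : R :=
  \sum_(j < N) m j.

(* The sum of m_j r_j^2: moment of inertia relative to the wx plane. *)
Definition inertia (R : realType) (N : nat) (m : 'I_N -> R)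
    (r : 'I_N -> R -> R) (t : R) : R :=
  \sum_(j < N) m j * r j t ^+ 2.

Definition gamma_minus (R : realType) (N : nat) (alpha beta : R -> R)
    (a b : 'I_N -> R) (i : 'I_N) (t : R) : R := alpha t - beta t + a i - b i.

Definition gamma_plus (R : realType) (N : nat) (alpha beta : R -> R)
    (a b : 'I_N -> R) (i : 'I_N) (t : R) : R := alpha t + beta t + a i + b i.

(* In the expressions of the theorem:
     radial_term     is  r_i (1 - r_i^2)^(1/2),
     radial_velocity is  r_i' / (1 - r_i^2)^(1/2).
   When r_i t = 1 at an interior time t, r_i has a maximum there, so r_i' t = 0
   and the quotients r_i' / (1 - r_i^2)^(1/2) and r_i'^2 / (1 - r_i^2) are 0 by
   the convention x / 0 = 0; this is the contribution of body i, since
   rho_i t = 0 is then a minimum of rho_i and rho_i' t = 0 as well. *)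
Definition radial_term (R : realType) (N : nat) (r : 'I_N -> R -> R)
    (i : 'I_N) (t : R) : R := r i t * Num.sqrt (1 - r i t ^+ 2).

Definition radial_velocity (R : realType) (N : nat) (r : 'I_N -> R -> R)
    (i : 'I_N) (t : R) : R := derive1 (r i) t / Num.sqrt (1 - r i t ^+ 2).

(* Main.v *)
Require Import Defs.
From HB Require Import structures.
From mathcomp Require Import all_boot all_order all_algebra.
From mathcomp Require Import all_classical all_reals all_analysis.
From mathcomp Require Import ring lra.
Import Order.TTheory GRing.Theory Num.Theory.
Import numFieldNormedType.Exports.
Local Open Scope classical_set_scope.
Local Open Scope ring_scope.

(* Each body's acceleration is a sum of pairwise forces plus a multiple of its
   position.  The force terms cancel in pairs in the derivatives of the angular
   momenta and match the derivative of the potential in that of the energy; the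
   multiple of the position contributes to neither, since q_i /\ q_i = 0 and
   q_i . q_i' = 0 on the sphere.  So all these quantities are constant, and the
   formulas follow by substituting q_i = (r e^(i A), rho e^(i B)), where
   r r' + rho rho' = 0 gives r rho' - r' rho = - r' / rho and
   r'^2 + rho'^2 = r'^2 / rho^2.  Both persist, as 0 = 0 under x / 0 = 0, where
   rho = 0: such a time is an interior minimum of rho.  Finally c_wx = J alpha'
   equals c1 provided J <> 0, which constancy of c_wx and nonconstancy of alpha
   force; likewise for c_yz. *)

(** * Sums over ordered and unordered pairs of bodies *)

(** Exchanging the two indices turns the sum into its opposite. Applied to the torques, this is the
    cancellation of action and reaction. *)
Lemma sum_neq_antisym (R : realType) (N : nat) (F : 'I_N -> 'I_N -> R) :
  (forall i j, F i j = - F j i) -> \sum_i \sum_(j | j != i) F i j = 0.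
Proof.
move=> F_anti; set S := LHS.
suff : S = - S by lra.
rewrite {1}/S (exchange_big_dep predT) //= -sumrN; apply: eq_bigr => i _.
rewrite -sumrN; apply: eq_big => [j|j _]; first by rewrite eq_sym.
exact: F_anti.
Qed.

(** Each unordered pair occurs twice on the left. This links the potential, summed over [i < j], to
    the forces, summed over [j != i]. *)
Lemma sum_neq_ltn (R : realType) (N : nat) (F : 'I_N -> 'I_N -> R) :
  \sum_i \sum_(j | j != i) F i j =
  \sum_(i < N) \sum_(j < N | (i < j)%N) (F i j + F j i).
Proof.
under [RHS]eq_bigr do rewrite big_split /=.
rewrite big_split /= [X in _ + X](exchange_big_dep predT) //= -big_split /=.
apply: eq_bigr => i _; rewrite (bigID (fun j : 'I_N => (i < j)%N)) /=.
by congr (_ + _); apply: eq_bigl => j; rewrite -val_eqE /=; case: ltngtP.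
Qed.

(** * Differentiation rules for pointwise expressions, and functions with zero derivative *)

Lemma is_derive_big (R : realType) (I : Type) (s : seq I) (P : pred I)
    (h : I -> R -> R) (dh : I -> R) (t : R) :
  (forall i, P i -> is_derive t 1 (h i) (dh i)) ->
  is_derive t 1 (fun x => \sum_(i <- s | P i) h i x) (\sum_(i <- s | P i) dh i).
Proof.
move=> hP; rewrite [X in is_derive _ _ X _](_ : _ = \sum_(i <- s | P i) h i).
  by elim/big_ind2 : _ => // [|] *; [exact: is_derive_cst|exact: is_deriveD].
by apply/funext => x; rewrite fct_sumE.
Qed.

Lemma is_derive_coord {R : realType} {m n : nat} {f : R -> 'M[R]_(m, n)}
    {t : R} (i : 'I_m) (j : 'I_n) :
  derivable f t 1 -> is_derive t 1 (fun x => f x i j) (derive1 f t i j).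
Proof.
move=> df; apply: DeriveDef; first exact: (derivable_mxP _ _ _).1.
by rewrite derive1E derive_mx // mxE.
Qed.

Lemma is_derive_mul {R : realType} {f g : R -> R} {t df dg : R} :
  is_derive t 1 f df -> is_derive t 1 g dg ->
  is_derive t 1 (fun x => f x * g x) (df * g t + f t * dg).
Proof.
move=> hf hg; rewrite (_ : (fun x => _) = f * g) //.
by apply: is_derive_eq; rewrite /GRing.scale /=; ring.
Qed.

Lemma is_derive_sub {R : realType} {f g : R -> R} {t df dg : R} :
  is_derive t 1 f df -> is_derive t 1 g dg ->
  is_derive t 1 (fun x => f x - g x) (df - dg).
Proof. by move=> hf hg; exact: (@is_deriveB R _ _ f g t 1). Qed.

Lemma is_derive_scale {R : realType} (c : R) {f : R -> R} {t df : R} :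
  is_derive t 1 f df -> is_derive t 1 (fun x => c * f x) (c * df).
Proof. exact: (@is_deriveZ R _ _ f c t 1 df). Qed.

(** By the mean value theorem between two points of [I]; being an interval, [I] contains the segment
    joining them. *)
Lemma is_derive0_constant (R : realType) (I : set R) (f : R -> R) :
  is_interval I -> (forall t, I t -> is_derive t 1 f 0) ->
  exists c, forall t, I t -> f t = c.
Proof.
move=> I_itv df.
have lt_eq x y : I x -> I y -> x < y -> f x = f y.
  move=> Ix Iy xy.
  have I_xy z : x <= z <= y -> I z by exact: I_itv.
  have [|z|c _ /eqP] := @MVT R f (fun=> 0) x y xy.
  - by move=> z; rewrite in_itv /= => /andP[/ltW xz /ltW zy]; apply/df/I_xy/andP.
  - apply: derivable_within_continuous => u.
    by rewrite in_itv /= => /I_xy/df[].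
  by rewrite mul0r subr_eq0 => /eqP.
have [[x Ix]|noI] := pselect (exists x, I x); last first.
  (* On an empty interval any constant will do. *)
  by exists 0 => t It; exfalso; apply: noI; exists t.
exists (f x) => t It; have [tx|xt|-> //] := ltgtP t x; first exact: lt_eq.
by apply/esym/lt_eq.
Qed.

(** * The inner product of R^4 *)

Section dot.
Context {R : realType}.
Implicit Types u v : 'rV[R]_4.

Lemma dotC u v : dot u v = dot v u.
Proof. by apply: eq_bigr => k _; rewrite mulrC. Qed.

Lemma dotDr u v1 v2 : dot u (v1 + v2) = dot u v1 + dot u v2.
Proof. by rewrite -big_split; apply: eq_bigr => k _; rewrite mxE mulrDr. Qed.

Lemma dotZr u c v : dot u (c *: v) = c * dot u v.
Proof. by rewrite mulr_sumr; apply: eq_bigr => k _; rewrite mxE mulrCA. Qed.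

Lemma dotNr u v : dot u (- v) = - dot u v.
Proof. by rewrite -scaleN1r dotZr mulN1r. Qed.

Lemma dot_sumr u (I : Type) (s : seq I) (P : pred I) (v : I -> 'rV[R]_4) :
  dot u (\sum_(i <- s | P i) v i) = \sum_(i <- s | P i) dot u (v i).
Proof.
elim/big_rec2 : _ => [|i x y _ <-]; last by rewrite dotDr.
by apply: big1 => k _; rewrite mxE mulr0.
Qed.

Lemma dotE u v : dot u v =
  u 0 wc * v 0 wc + u 0 xc * v 0 xc + u 0 yc * v 0 yc + u 0 zc * v 0 zc.
Proof.
rewrite /dot !big_ord_recr big_ord0 /= add0r.
by congr (_ + _ + _ + _); congr (u 0 _ * v 0 _); apply: val_inj.
Qed.

(** Cauchy-Schwarz for unit vectors: the squared norms of [u + v] and [u - v] are 2 + 2 u.v and 2 -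
    2 u.v, so both factors of 1 - (u.v)^2 are nonnegative. *)
Lemma dot_unit_sqr_le1 u v : dot u u = 1 -> dot v v = 1 -> dot u v ^+ 2 <= 1.
Proof.
move=> u1 v1.
have dot_ge0 (w : 'rV[R]_4) : 0 <= dot w w.
  by apply: sumr_ge0 => k _; rewrite -expr2 sqr_ge0.
have D c : dot (u + c *: v) (u + c *: v) = 1 + 2 * c * dot u v + c ^+ 2.
  rewrite dotDr dotZr (dotC _ u) (dotC _ v) !dotDr !dotZr u1 v1 (dotC v u); ring.
have := dot_ge0 (u + 1 *: v); have := dot_ge0 (u + (-1) *: v).
rewrite !D => h1 h2; have : 0 <= (1 - dot u v) * (1 + dot u v).
  by apply: mulr_ge0; lra.
lra.
Qed.

Lemma is_derive_dot {f g : R -> 'rV[R]_4} {t : R} :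
  derivable f t 1 -> derivable g t 1 ->
  is_derive t 1 (fun x => dot (f x) (g x))
    (dot (derive1 f t) (g t) + dot (f t) (derive1 g t)).
Proof.
move=> df dg; rewrite /dot -big_split; apply: is_derive_big => k _.
by apply: is_derive_mul; exact: is_derive_coord.
Qed.

End dot.

(** * The potential of a pair *)

(** Reconciles the exponent 3/2 of the equations of motion with the square root in the potential. *)
Lemma powR_3_2 (R : realType) (x : R) : 0 < x -> x `^ (3 / 2) = x * Num.sqrt x.
Proof.
move=> x_gt0; have -> : 3 / 2 = 1 + 2^-1 :> R by field.
rewrite powRD ?gt_eqF ?implybT // powRr1 ?powR12_sqrt //; exact: ltW.
Qed.

(* The potential of a pair as a function of q_ij:
   x / sqrt (1 - x^2) = cot (acos x). *)
Lemma is_derive_cotangent {R : realType} {x : R} : x ^+ 2 < 1 ->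
  is_derive x 1 (fun y => y / Num.sqrt (1 - y ^+ 2)) ((1 - x ^+ 2) `^ (3 / 2))^-1.
Proof.
move=> x2_lt1; have d_gt0 : 0 < 1 - x ^+ 2 by rewrite subr_gt0.
have s_gt0 : 0 < Num.sqrt (1 - x ^+ 2) by rewrite sqrtr_gt0.
have s2 : Num.sqrt (1 - x ^+ 2) ^+ 2 = 1 - x ^+ 2 by rewrite sqr_sqrtr // ltW.
have dsq : is_derive x 1 (fun y : R => 1 - y ^+ 2) (- (2 * x)).
  apply: is_derive_eq; rewrite /GRing.scale /=; ring.
have dsqrt : is_derive x 1 (fun y => Num.sqrt (1 - y ^+ 2))
    ((2 * Num.sqrt (1 - x ^+ 2))^-1 * - (2 * x)).
  exact: (@is_derive1_comp R Num.sqrt (fun y => 1 - y ^+ 2) x _ _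
    (is_derive1_sqrt d_gt0) dsq).
have dinv := @is_deriveV R (fun y => Num.sqrt (1 - y ^+ 2)) x _ 1
  (lt0r_neq0 s_gt0) dsqrt.
have := @is_derive_mul R id _ x _ _ (is_derive_id _ _) dinv.
move/is_derive_eq; apply.
rewrite powR_3_2 // /GRing.scale /=.
set s := Num.sqrt _ in s_gt0 s2 *; have s_neq0 := lt0r_neq0 s_gt0.
(* The product rule gives this sum; since s^2 + x^2 = 1, it equals 1 / s^3. *)
transitivity (s^-1 + x ^+ 2 / s ^+ 3); first by field.
by rewrite -s2 (_ : x ^+ 2 = 1 - s ^+ 2); [field | rewrite s2; ring].
Qed.

(** * Conservation of angular momentum and energy *)

Section conservation.
Context {R : realType} {N : nat} {m : 'I_N -> R} {I : set R}.
Context {q : 'I_N -> R -> 'rV[R]_4}.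
Hypothesis I_open : open I.
Hypothesis I_itv : is_interval I.
Hypothesis q_sol : curved_Nbody_solution m I q.

Let weight t i j := (1 - dot (q i t) (q j t) ^+ 2) `^ (3 / 2).

Let weightC t i j : weight t i j = weight t j i.
Proof. by rewrite /weight dotC. Qed.

Lemma angular_momentum_constant (u v : 'I_4) :
  exists c, forall t, I t -> angular_momentum m q u v t = c.
Proof.
apply: is_derive0_constant => // t It.
have accE i k : acceleration m q i t 0 k =
    \sum_(j | j != i) m j / weight t i j *
      (q j t 0 k - dot (q i t) (q j t) * q i t 0 k)
    - dot (derive1 (q i) t) (derive1 (q i) t) * q i t 0 k.
  by rewrite !mxE summxE; congr (_ - _); apply: eq_bigr => j _; rewrite !mxE.
(* Zero is written as the total torque, antisymmetric in [i] and [j], so that the derivative can be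
   compared body by body. *)
have -> : 0 = \sum_i \sum_(j | j != i) m i * m j / weight t i j *
    (q i t 0 u * q j t 0 v - q j t 0 u * q i t 0 v).
  by rewrite sum_neq_antisym // => i j; rewrite weightC; ring.
apply: is_derive_big => i _.
have dq k := is_derive_coord 0 k (sol_derivable q_sol (i := i) It).
have := fun k => is_derive_coord 0 k (sol_derivable2 q_sol (i := i) It).
rewrite (sol_motion q_sol) // => ddq.
have /is_derive_eq := is_derive_scale (m i) (is_derive_sub
  (is_derive_mul (dq u) (ddq v)) (is_derive_mul (ddq u) (dq v))).
apply; rewrite !accE.
(* The products of velocities cancel, and so does the multiple of q_i in the acceleration. *)
transitivity (m i * (q i t 0 u *
  (\sum_(j | j != i) m j / weight t i j *
     (q j t 0 v - dot (q i t) (q j t) * q i t 0 v)) -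
  (\sum_(j | j != i) m j / weight t i j *
     (q j t 0 u - dot (q i t) (q j t) * q i t 0 u)) * q i t 0 v)).
  by ring.
rewrite mulr_sumr mulr_suml -sumrB mulr_sumr.
by apply: eq_bigr => j _; ring.
Qed.

(** Half the derivative of q_i . q_i = 1, an identity that holds near [t] because [I] is open. *)
Lemma dot_velocity_position {i t} : I t -> dot (derive1 (q i) t) (q i t) = 0.
Proof.
move=> It; have dq := sol_derivable q_sol (i := i) It.
have [_ dE] := is_derive_dot dq dq.
have : 'D_1 (fun x => dot (q i x) (q i x)) t = 'D_1 (cst (1 : R)) t.
  apply: near_eq_derive; near=> x; apply: (sol_sphere q_sol).
  by near: x; exact: open_nbhs_nbhs.
rewrite dE derive_cst (dotC (q i t)); lra.
Unshelve. all: by end_near. Qed.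

(** Cauchy-Schwarz, with equality excluded by nonsingularity; this makes the pair potential
    differentiable. *)
Lemma dot_sqr_lt1 {i j t} : I t -> i != j -> dot (q i t) (q j t) ^+ 2 < 1.
Proof.
move=> It ij; rewrite lt_neqAle; apply/andP; split.
  by apply/eqP; exact: (sol_nonsingular q_sol It ij).
by apply: dot_unit_sqr_le1; exact: (sol_sphere q_sol _ It).
Qed.

(** By the chain rule a pair contributes a multiple of q_i' . q_j + q_i . q_j'; the two summands are
    the [(i, j)] and [(j, i)] terms of the ordered sum. *)
Let is_derive_force {t} : I t ->
  is_derive t 1 (force_function m q)
    (\sum_i \sum_(j | j != i)
       m i * m j / weight t i j * dot (derive1 (q i) t) (q j t)).
Proof.
move=> It; rewrite sum_neq_ltn.
apply: is_derive_big => i _; apply: is_derive_big => j ij.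
have := is_derive_dot (sol_derivable q_sol (i := i) It)
  (sol_derivable q_sol (i := j) It).
have ne_ij : i != j by rewrite -val_eqE /= ltn_eqF.
have cot := is_derive_cotangent (dot_sqr_lt1 It ne_ij).
move=> ddot; have := is_derive_scale (m i * m j) (is_derive1_comp cot ddot).
rewrite (_ : (fun x => _) = fun x => m i * m j * dot (q i x) (q j x) /
    Num.sqrt (1 - dot (q i x) (q j x) ^+ 2)); last first.
  by apply/funext => x; rewrite /= mulrA.
move/is_derive_eq; apply.
rewrite (weightC t j i) (dotC (q i t) (derive1 _ _)) /weight; ring.
Qed.

Let is_derive_kinetic {t} : I t ->
  is_derive t 1
    (fun x => 2^-1 * \sum_(i < N) m i * dot (derive1 (q i) x) (derive1 (q i) x))
    (\sum_i \sum_(j | j != i)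
       m i * m j / weight t i j * dot (derive1 (q i) t) (q j t)).
Proof.
move=> It.
have dT : is_derive t 1
    (fun x => \sum_(i < N) m i * dot (derive1 (q i) x) (derive1 (q i) x))
    (\sum_(i < N) m i * (2 * dot (derive1 (q i) t) (acceleration m q i t))).
  apply: is_derive_big => i _; apply: is_derive_scale.
  have ddq := sol_derivable2 q_sol (i := i) It.
  apply: is_derive_eq; first exact: (is_derive_dot ddq ddq).
  by rewrite (sol_motion q_sol) // (dotC (acceleration _ _ _ _)); ring.
have /is_derive_eq := is_derive_scale 2^-1 dT; apply.
rewrite mulr_sumr; apply: eq_bigr => i _.
(* Orthogonality of q_i' and q_i removes the constraint term here, and below the component of each
   attraction along q_i. *)
rewrite dotDr dotNr dotZr dot_velocity_position // mulr0 subr0 dot_sumr.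
rewrite 3!mulr_sumr; apply: eq_bigr => j _.
rewrite dotZr dotDr dotNr dotZr dot_velocity_position // -/(weight t i j).
(* With the inverse generalized, [field] asks for no condition on the weight. *)
by move: (weight t i j)^-1 => k; field.
Qed.

Lemma total_energy_constant :
  exists h, forall t, I t -> total_energy m q t = h.
Proof.
apply: is_derive0_constant => // t It.
have := is_derive_sub (is_derive_kinetic It) (is_derive_force It).
by rewrite subrr.
Qed.

End conservation.

(** * Derivatives on an open set, and in polar coordinates *)

(** Derivatives are local and [I] is open. This allows differentiating the polar expressions of the
    coordinates, which are known on [I] only. *)
Lemma is_derive_eq_on (R : realType) (I : set R) (f g : R -> R) (t df dg : R) :
  open I -> I t -> (forall x, I x -> f x = g x) ->
  is_derive t 1 f df -> is_derive t 1 g dg -> df = dg.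
Proof.
move=> I_open It fg [_ <-] [_ <-]; apply: near_eq_derive; near=> x.
by apply: fg; near: x; exact: open_nbhs_nbhs.
Unshelve. all: by end_near. Qed.

(** Fermat's rule on a ball around [c] inside [I]. *)
Lemma derive1_interior_min (R : realType) (I : set R) (f : R -> R) (c : R) :
  open I -> I c -> (forall t, I t -> derivable f t 1) ->
  (forall t, I t -> f c <= f t) -> derive1 f c = 0.
Proof.
move=> I_open Ic df f_min.
have /nbhs_ballP[e /= e_gt0 ball_I] : nbhs c I by exact: open_nbhs_nbhs.
have I_e x : x \in `]c - e, c + e[%R -> I x.
  rewrite in_itv /= => /andP[xl xr]; apply: ball_I; rewrite /ball /=.
  by rewrite ltr_norml; lra.
have [] := @derive1_at_min R f (c - e) (c + e) c.
- by lra.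
- by move=> x /I_e/df.
- by rewrite in_itv /=; lra.
- by move=> x /I_e/f_min.
by rewrite derive1E.
Qed.

Lemma is_derive_polar_cos {R : realType} {rad phi : R -> R} (a : R) {t drad dphi : R} :
  is_derive t 1 rad drad -> is_derive t 1 phi dphi ->
  is_derive t 1 (fun x => rad x * cos (phi x + a))
    (drad * cos (phi t + a) - rad t * dphi * sin (phi t + a)).
Proof.
move=> hrad hphi.
have hphia : is_derive t 1 (fun x => phi x + a) dphi.
  have := is_derive_sub hphi (is_derive_cst (- a) t 1); rewrite subr0.
  by rewrite (_ : (fun x => _) = fun x => phi x + a) //;
     apply/funext => x; rewrite /cst opprK.
have hcos : is_derive t 1 (fun x => cos (phi x + a)) (- sin (phi t + a) * dphi).
  exact: (@is_derive1_comp R cos (fun x => phi x + a)).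
have := is_derive_mul hrad hcos; move/is_derive_eq; apply; ring.
Qed.

(** The cosine rule with phase shifted by a quarter turn. *)
Lemma is_derive_polar_sin {R : realType} {rad phi : R -> R} (a : R) {t drad dphi : R} :
  is_derive t 1 rad drad -> is_derive t 1 phi dphi ->
  is_derive t 1 (fun x => rad x * sin (phi x + a))
    (drad * sin (phi t + a) + rad t * dphi * cos (phi t + a)).
Proof.
move=> hrad hphi.
have -> : (fun x => rad x * sin (phi x + a)) =
    fun x => rad x * cos (phi x + (a - pi / 2)).
  by apply/funext => x; rewrite addrA cosBpihalf.
have /is_derive_eq := is_derive_polar_cos (a - pi / 2) hrad hphi; apply.
rewrite !addrA cosBpihalf sinBpihalf; ring.
Qed.

Lemma derivable_is_derive1 {R : realType} {f : R -> R} {t : R} :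
  derivable f t 1 -> is_derive t 1 f (derive1 f t).
Proof. by rewrite derive1E; exact: derivableP. Qed.

(* If J vanished at one time, then the constant J f' would be 0; as J f' = c
   wherever J <> 0, J and hence f' = c / 0 = 0 would vanish identically. *)
Lemma momentum_denominator_neq0 (R : realType) (I : set R) (J f : R -> R) (c k : R) :
  is_interval I -> (forall t, I t -> derivable f t 1) ->
  ~ (exists d, forall t, I t -> f t = d) -> c <> 0 ->
  (forall t, I t -> derive1 f t = c / J t) ->
  (forall t, I t -> J t * derive1 f t = k) ->
  forall t, I t -> J t != 0.
Proof.
move=> I_itv df f_noncst /eqP c_neq0 dfE Jf t It; apply/eqP => Jt0; apply: f_noncst.
apply: is_derive0_constant => // s Is.
have k0 : k = 0 by rewrite -(Jf t It) Jt0 mul0r.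
have [Js0|Js_neq0] := eqVneq (J s) 0.
  by have := derivable_is_derive1 (df s Is); rewrite dfE // Js0 invr0 mulr0.
have := Jf s Is; rewrite k0 dfE // mulrC divfK // => /eqP.
by rewrite (negbTE c_neq0).
Qed.

(** * One body in elliptic-elliptic coordinates *)

(** A coordinate of the bivector x /\ v: for position and velocity, the angular momentum per unit
    mass. *)
Definition wedge {R : realType} (x v : 'rV[R]_4) (k l : 'I_4) : R :=
  x 0 k * v 0 l - v 0 k * x 0 l.

Section elliptic_elliptic.
Context {R : realType} {N : nat} {I : set R} {q : 'I_N -> R -> 'rV[R]_4}.
Context {r rho : 'I_N -> R -> R} {alpha beta : R -> R} {a b : 'I_N -> R}.
Hypothesis I_open : open I.
Hypothesis q_derivable : forall i t, I t -> derivable (q i) t 1.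
Hypothesis q_form : positive_elliptic_elliptic I q r rho alpha beta a b.

Context (i : 'I_N) {t : R}.
Hypothesis It : I t.

Let dr := derivable_is_derive1 (ee_derivable_r q_form (i := i) It).
Let drho := derivable_is_derive1 (ee_derivable_rho q_form (i := i) It).
Let dalpha := derivable_is_derive1 (ee_derivable_alpha q_form It).
Let dbeta := derivable_is_derive1 (ee_derivable_beta q_form It).
Let dq k := is_derive_coord 0 k (q_derivable i t It).

Lemma velocity_w : derive1 (q i) t 0 wc =
  derive1 (r i) t * cos (alpha t + a i)
  - r i t * derive1 alpha t * sin (alpha t + a i).
Proof.
exact: is_derive_eq_on I_open It (ee_w q_form i) (dq wc)
  (is_derive_polar_cos (a i) dr dalpha).
Qed.

Lemma velocity_x : derive1 (q i) t 0 xc =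
  derive1 (r i) t * sin (alpha t + a i)
  + r i t * derive1 alpha t * cos (alpha t + a i).
Proof.
exact: is_derive_eq_on I_open It (ee_x q_form i) (dq xc)
  (is_derive_polar_sin (a i) dr dalpha).
Qed.

Lemma velocity_y : derive1 (q i) t 0 yc =
  derive1 (rho i) t * cos (beta t + b i)
  - rho i t * derive1 beta t * sin (beta t + b i).
Proof.
exact: is_derive_eq_on I_open It (ee_y q_form i) (dq yc)
  (is_derive_polar_cos (b i) drho dbeta).
Qed.

Lemma velocity_z : derive1 (q i) t 0 zc =
  derive1 (rho i) t * sin (beta t + b i)
  + rho i t * derive1 beta t * cos (beta t + b i).
Proof.
exact: is_derive_eq_on I_open It (ee_z q_form i) (dq zc)
  (is_derive_polar_sin (b i) drho dbeta).
Qed.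

Let r_dr : r i t * derive1 (r i) t + rho i t * derive1 (rho i) t = 0.
Proof.
(* The sum r^2 + rho^2 is put in the form r r - (-1) rho rho to fit the rules for differences and
   multiples. *)
have d2 := is_derive_sub (is_derive_mul dr dr)
  (is_derive_scale (-1) (is_derive_mul drho drho)).
have c2 := is_derive_cst (1 : R) t 1.
have := is_derive_eq_on _ _ _ _ _ _ _ I_open It _ d2 c2.
suff H x : I x -> r i x * r i x - -1 * (rho i x * rho i x) = cst 1 x.
  by move=> /(_ H); lra.
by move=> Ix; rewrite /cst; have := ee_r_rho q_form i Ix; lra.
Qed.

(** The sign condition rho >= 0 selects this root. *)
Let sqrt_r : Num.sqrt (1 - r i t ^+ 2) = rho i t.
Proof.
have /andP[rho_ge0 _] := ee_rho_bounds q_form i It.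
by rewrite -(ee_r_rho q_form i It) addrAC subrr add0r sqrtr_sqr ger0_norm.
Qed.

Let drho0 : rho i t = 0 -> derive1 (rho i) t = 0.
Proof.
move=> rho0; apply: (@derive1_interior_min _ I) => // [s Is|s Is].
  exact: (ee_derivable_rho q_form (i := i) Is).
by have /andP[] := ee_rho_bounds q_form i Is; rewrite rho0.
Qed.

(** Here r r' = 0 while r^2 = 1. *)
Let dr0 : rho i t = 0 -> derive1 (r i) t = 0.
Proof.
move=> rho0; have /eqP := r_dr; rewrite rho0 mul0r addr0 mulf_eq0.
have : r i t ^+ 2 = 1 by rewrite -(ee_r_rho q_form i It) rho0; ring.
by case: eqVneq => [-> /eqP|_ _ /eqP //]; rewrite expr0n eq_sym oner_eq0.
Qed.

Lemma radial_termE : radial_term r i t = r i t * rho i t.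
Proof. by rewrite /radial_term sqrt_r. Qed.

Lemma radial_velocityE : radial_velocity r i t =
  derive1 (r i) t * rho i t - r i t * derive1 (rho i) t.
Proof.
rewrite /radial_velocity sqrt_r.
(* At rho = 0 the quotient is 0 by default, and both derivatives on the right vanish. *)
have [rho0|rho_neq0] := eqVneq (rho i t) 0.
  by rewrite dr0 // drho0 //; ring.
apply: (mulIf rho_neq0); rewrite divfK //.
(* After multiplication by rho, using rho rho' = - r r', the right side becomes r' (rho^2 + r^2) =
   r'. *)
transitivity (derive1 (r i) t * rho i t ^+ 2 - r i t * (rho i t * derive1 (rho i) t));
  last by ring.
have -> : rho i t * derive1 (rho i) t = - (r i t * derive1 (r i) t).
  by have := r_dr; lra.
have := ee_r_rho q_form i It => r_rho.
rewrite -[LHS]mulr1 -r_rho; ring.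
Qed.

Lemma radial_kinetic : derive1 (r i) t ^+ 2 + derive1 (rho i) t ^+ 2 =
  derive1 (r i) t ^+ 2 / (1 - r i t ^+ 2).
Proof.
have r_rho := ee_r_rho q_form i It.
have -> : 1 - r i t ^+ 2 = rho i t ^+ 2 by rewrite -r_rho; ring.
have [rho0|rho_neq0] := eqVneq (rho i t) 0.
  by rewrite dr0 // drho0 //; ring.
apply: (mulIf (expf_neq0 2 rho_neq0)); rewrite divfK ?expf_neq0 //.
transitivity (derive1 (r i) t ^+ 2 * rho i t ^+ 2 +
  (rho i t * derive1 (rho i) t) ^+ 2); first by ring.
have -> : rho i t * derive1 (rho i) t = - (r i t * derive1 (r i) t).
  by have := r_dr; lra.
(* Multiplied by rho^2, the left side has become r'^2 rho^2 + r^2 r'^2. *)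
transitivity (derive1 (r i) t ^+ 2 * (r i t ^+ 2 + rho i t ^+ 2)); first by ring.
by rewrite r_rho mulr1.
Qed.

Lemma kinetic_energyE : dot (derive1 (q i) t) (derive1 (q i) t) =
  derive1 (r i) t ^+ 2 / (1 - r i t ^+ 2)
  + r i t ^+ 2 * derive1 alpha t ^+ 2 + (1 - r i t ^+ 2) * derive1 beta t ^+ 2.
Proof.
rewrite dotE velocity_w velocity_x velocity_y velocity_z -radial_kinetic.
have -> : 1 - r i t ^+ 2 = rho i t ^+ 2 by rewrite -(ee_r_rho q_form i It); ring.
have c2 x : cos x ^+ 2 = 1 - sin x ^+ 2 :> R by rewrite -(cos2Dsin2 x) addrK.
ring: (c2 (alpha t + a i)) (c2 (beta t + b i)).
Qed.

Local Notation gm := (gamma_minus alpha beta a b i t).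
Local Notation gp := (gamma_plus alpha beta a b i t).

(** Grouped as a difference of the two phases, ready for the addition formulas. *)
Let gmE : gm = (alpha t + a i) - (beta t + b i).
Proof. by rewrite /gamma_minus; ring. Qed.

Let gpE : gp = (alpha t + a i) + (beta t + b i).
Proof. by rewrite /gamma_plus; ring. Qed.

Local Notation p := (radial_term r i t).
Local Notation s := (radial_velocity r i t).
Local Notation da := (derive1 alpha t).
Local Notation db := (derive1 beta t).
Local Notation momentum u v := (wedge (q i t) (derive1 (q i) t) u v).

Lemma momentum_wx : momentum wc xc = r i t ^+ 2 * da.
Proof.
rewrite /wedge velocity_w velocity_x (ee_w q_form i It) (ee_x q_form i It).
have c2 x : cos x ^+ 2 = 1 - sin x ^+ 2 :> R by rewrite -(cos2Dsin2 x) addrK.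
ring: (c2 (alpha t + a i)).
Qed.

Lemma momentum_yz : momentum yc zc = (1 - r i t ^+ 2) * db.
Proof.
have -> : 1 - r i t ^+ 2 = rho i t ^+ 2 by rewrite -(ee_r_rho q_form i It); ring.
rewrite /wedge velocity_y velocity_z (ee_y q_form i It) (ee_z q_form i It).
have c2 x : cos x ^+ 2 = 1 - sin x ^+ 2 :> R by rewrite -(cos2Dsin2 x) addrK.
ring: (c2 (beta t + b i)).
Qed.

(** With phases A and B, the left side is p (alpha' sin A cos B - beta' cos A sin B) - s cos A cos
    B; product-to-sum identities finish. The other mixed planes are alike. *)
Lemma momentum_wy : momentum wc yc =
  2^-1 * (p * (da + db) * sin gm + p * (da - db) * sin gp - s * cos gm - s * cos gp).
Proof.
rewrite /wedge velocity_w velocity_y (ee_w q_form i It) (ee_y q_form i It).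
rewrite radial_termE radial_velocityE gmE gpE.
by move: (alpha t + a i) (beta t + b i) => A B; rewrite cosB sinB cosD sinD; field.
Qed.

Lemma momentum_wz : momentum wc zc =
  2^-1 * (p * (da + db) * cos gm - p * (da - db) * cos gp + s * sin gm - s * sin gp).
Proof.
rewrite /wedge velocity_w velocity_z (ee_w q_form i It) (ee_z q_form i It).
rewrite radial_termE radial_velocityE gmE gpE.
by move: (alpha t + a i) (beta t + b i) => A B; rewrite cosB sinB cosD sinD; field.
Qed.

Lemma momentum_xy : momentum xc yc =
  - (2^-1 * (p * (da + db) * cos gm + p * (da - db) * cos gp
             + s * sin gm + s * sin gp)).
Proof.
rewrite /wedge velocity_x velocity_y (ee_x q_form i It) (ee_y q_form i It).
rewrite radial_termE radial_velocityE gmE gpE.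
by move: (alpha t + a i) (beta t + b i) => A B; rewrite cosB sinB cosD sinD; field.
Qed.

Lemma momentum_xz : momentum xc zc =
  2^-1 * (p * (da + db) * sin gm - p * (da - db) * sin gp - s * cos gm + s * cos gp).
Proof.
rewrite /wedge velocity_x velocity_z (ee_x q_form i It) (ee_z q_form i It).
rewrite radial_termE radial_velocityE gmE gpE.
by move: (alpha t + a i) (beta t + b i) => A B; rewrite cosB sinB cosD sinD; field.
Qed.

End elliptic_elliptic.

Theorem proposition3 (R : realType) (N : nat) (N_ge2 : (2 <= N)%N)
    (m : 'I_N -> R) (m_gt0 : forall i, 0 < m i)
    (I : set R) (I_open : open I) (I_itv : is_interval I)
    (q : 'I_N -> R -> 'rV[R]_4) (r rho : 'I_N -> R -> R)
    (alpha beta : R -> R) (a b : 'I_N -> R) (c1 c2 : R)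
    (q_sol : curved_Nbody_solution m I q)
    (q_form : positive_elliptic_elliptic I q r rho alpha beta a b)
    (c1_neq0 : c1 <> 0) (c2_neq0 : c2 <> 0)
    (alphaE : forall t, I t -> derive1 alpha t = c1 / inertia m r t)
    (betaE : forall t, I t ->
       derive1 beta t = c2 / (total_mass m - inertia m r t)) :
  let gm := gamma_minus alpha beta a b in
  let gp := gamma_plus alpha beta a b in
  let p := radial_term r in
  let s := radial_velocity r in
  let da := derive1 alpha in
  let db := derive1 beta in
  [/\ exists h : R, forall t, I t ->
        total_energy m q t = h /\
        h = \sum_(i < N) m i * derive1 (r i) t ^+ 2 / (2 * (1 - r i t ^+ 2))
            + c1 ^+ 2 / (2 * inertia m r t)
            + c2 ^+ 2 / (2 * (total_mass m - inertia m r t))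
            - \sum_(i < N) \sum_(j < N | (i < j)%N)
                m i * m j * dot (q i t) (q j t)
                / Num.sqrt (1 - dot (q i t) (q j t) ^+ 2),
      forall t, I t ->
        angular_momentum m q wc xc t = c1 /\
        angular_momentum m q yc zc t = c2,
      exists c_wy : R, forall t, I t ->
        angular_momentum m q wc yc t = c_wy /\
        c_wy = 2^-1 * \sum_(i < N) m i *
          (p i t * (da t + db t) * sin (gm i t)
           + p i t * (da t - db t) * sin (gp i t)
           - s i t * cos (gm i t) - s i t * cos (gp i t)),
      exists c_wz : R, forall t, I t ->
        angular_momentum m q wc zc t = c_wz /\
        c_wz = 2^-1 * \sum_(i < N) m i *
          (p i t * (da t + db t) * cos (gm i t)
           - p i t * (da t - db t) * cos (gp i t)
           + s i t * sin (gm i t) - s i t * sin (gp i t)) &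
      (exists c_xy : R, forall t, I t ->
        angular_momentum m q xc yc t = c_xy /\
        c_xy = - (2^-1 * \sum_(i < N) m i *
          (p i t * (da t + db t) * cos (gm i t)
           + p i t * (da t - db t) * cos (gp i t)
           + s i t * sin (gm i t) + s i t * sin (gp i t)))) /\
      (exists c_xz : R, forall t, I t ->
        angular_momentum m q xc zc t = c_xz /\
        c_xz = 2^-1 * \sum_(i < N) m i *
          (p i t * (da t + db t) * sin (gm i t)
           - p i t * (da t - db t) * sin (gp i t)
           - s i t * cos (gm i t) + s i t * cos (gp i t)))].
Proof.
move=> gm gp p s da db.
have q_derivable i t : I t -> derivable (q i) t 1.
  by move=> It; exact: (sol_derivable q_sol It).
have L_constant := angular_momentum_constant I_itv q_sol.
have L_wx t : I t -> angular_momentum m q wc xc t = inertia m r t * da t.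
  move=> It; rewrite mulr_suml; apply: eq_bigr => i _.
  by rewrite -mulrA -(momentum_wx I_open q_derivable q_form i It).
have L_yz t : I t ->
    angular_momentum m q yc zc t = (total_mass m - inertia m r t) * db t.
  move=> It; rewrite -sumrB mulr_suml; apply: eq_bigr => i _.
  rewrite -/(wedge _ _ _ _) (momentum_yz I_open q_derivable q_form i It).
  by rewrite /db; ring.
(* Rules out the default value of c1 / 0 before the quotient is simplified; [k] is the conserved
   value of c_wx. *)
have J_neq0 t : I t -> inertia m r t != 0.
  have [k Lk] := L_constant wc xc.
  apply: (@momentum_denominator_neq0 _ _ _ alpha c1 k) => // [u Iu||u Iu].
  - exact: (ee_derivable_alpha q_form Iu).
  - exact: (ee_alpha_nonconstant q_form).
  - by rewrite -L_wx // Lk.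
have K_neq0 t : I t -> total_mass m - inertia m r t != 0.
  have [k Lk] := L_constant yc zc.
  apply: (@momentum_denominator_neq0 _ _ (fun t => total_mass m - inertia m r t)
    beta c2 k) => // [u Iu||u Iu].
  - exact: (ee_derivable_beta q_form Iu).
  - exact: (ee_beta_nonconstant q_form).
  - by rewrite -L_yz // Lk.
split.
- have [h hE] := total_energy_constant I_open I_itv q_sol.
  exists h => t It; split; first exact: hE.
  rewrite -(hE t It) /total_energy /force_function; congr (_ - _).
  under eq_bigr do
    rewrite (kinetic_energyE I_open q_derivable q_form _ It) -/da -/db 2!mulrDr.
  (* The kinetic energy splits into the radial part and the rotations in the wx and yz planes. *)
  rewrite 2!big_split /= 2!mulrDr; congr (_ + _ + _).
  + rewrite mulr_sumr; apply: eq_bigr => i _.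
    by rewrite invfM; ring.
  + under eq_bigr do rewrite mulrA.
    rewrite -mulr_suml -/(inertia m r t) /da alphaE //.
    by field; exact: J_neq0.
  (* The moment of inertia for the yz plane is the sum of m_i (1 - r_i^2), that is M - J. *)
  + under eq_bigr do rewrite mulrA mulrBr mulr1.
    rewrite -mulr_suml sumrB -/(inertia m r t) -/(total_mass m) /db betaE //.
    by field; exact: K_neq0.
- move=> t It; rewrite L_wx // L_yz // /da /db alphaE // betaE //.
  by split; rewrite mulrC divfK //; [exact: J_neq0 | exact: K_neq0].
(* For the mixed planes the constant comes from conservation and the formula from summing the
   one-body identity. *)
- have [c cE] := L_constant wc yc; exists c => t It; split; first exact: cE.
  rewrite -(cE t It) mulr_sumr; apply: eq_bigr => i _; rewrite mulrCA.
  by rewrite -(momentum_wy I_open q_derivable q_form i It).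
- have [c cE] := L_constant wc zc; exists c => t It; split; first exact: cE.
  rewrite -(cE t It) mulr_sumr; apply: eq_bigr => i _; rewrite mulrCA.
  by rewrite -(momentum_wz I_open q_derivable q_form i It).
- split.
    have [c cE] := L_constant xc yc; exists c => t It; split; first exact: cE.
    rewrite -(cE t It) mulr_sumr -sumrN; apply: eq_bigr => i _.
    by rewrite -/(wedge _ _ _ _) (momentum_xy I_open q_derivable q_form i It) mulrN mulrCA.
  have [c cE] := L_constant xc zc; exists c => t It; split; first exact: cE.
  rewrite -(cE t It) mulr_sumr; apply: eq_bigr => i _; rewrite mulrCA.
  by rewrite -(momentum_xz I_open q_derivable q_form i It).
Qed.
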